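(* Let $P=\langle X\mid R\rangle$ be a presentation and let $\Gamma(P)$ be its associated weighted directed graph. Then $P$ satisfies condition $\tau'$ if and only if each directed cycle in $\Gamma(P)$ of length at least $3$ has weight greater than or equal to $2$. Moreover, $P$ satisfies condition $\tau'_{<}$ if and only if each directed cycle in $\Gamma(P)$ of length at least $3$ has weight greater than $2$.
   Context: **Presentations and diagrams.** For a presentation $P=\langle X\mid R\rangle$ the relators are assumed cyclically reduced, and no relator is a cyclic permutation of another relator or of the inverse of another relator. $R^*$ is the set of all cyclic permutations of elements of $R$ and of their inverses. A piece is a nonempty word which is a common prefix of two different elements of $R^*$. $K_P$ is the standard $2$-complex of $P$. A diagram over $P$ is a combinatorial map $\varphi\colon M\to K_P$ (open cells map homeomorphically onto open cells), where $M$ is obtained from a combinatorial cell structure on the $2$-sphere by removing some (possibly none) open $2$-cells; it is a spherical, disk or annular diagram if respectively $0$, $1$, $2$ open $2$-cells are removed. $\partial M$ is the boundary of $M$ in the sphere. Cells of dimension $0,1,2$ are called vertices, edges, faces. Via $\varphi$, edges of $M$ are labeled by elements of $X$ and their inverses, and the boundary label of an oriented face, read from any vertex, is an element of $R^*$. A diagram is reducible if it contains two faces $f,f'$ such that $\partial f\cap\partial f'$ contains an edge $e$ for which the boundary labels of $f$ and $f'$, read with opposite orientations and starting at an endpoint of $e$ (traversing $e$ first), coincide; otherwise it is reduced. The degree $d(v)$ of a vertex $v$ is the number of edges incident to $v$ (loops counted twice). A vertex is interior if it is not in $\partial M$. **Convention.** In a reduced diagram, interior vertices of degree $2$ are removed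 (merging the two incident edges), so that interior edges are labeled by pieces; the length $\ell(e)$ of such an edge is the length of its label, i.e. the number of original edges glued to form it. **Conditions $\tau'$ and $\tau'_{<}$.** A corner $c$ of a face $f$ at an interior vertex $v$ lies between two consecutive edges at $v$, of lengths $\ell_1(c),\ell_2(c)$; $\ell_r(c)$ is the length of the relator corresponding to $f$. Put $d'_F(v)=\sum_{c\ni v}\frac{\ell_1(c)+\ell_2(c)}{\ell_r(c)}$, the sum over all corners at $v$. $P$ satisfies $\tau'$ (resp. $\tau'_{<}$) if $d'_F(v)\le d(v)-2$ (resp. $d'_F(v)<d(v)-2$) for every interior vertex $v$ of every reduced diagram over $P$ (with no interior vertices of degree $2$). **The graph $\Gamma(P)$.** Its vertices are the tuples $(r,p,q)$ such that $r\in R^*$, $p$ and $q$ are pieces, and $r$ can be written as $r=qsp$ without cancellations for some (possibly empty) word $s$. There is a directed edge $(r,p,q)\to(r',p',q')$ if $p'=q^{-1}$ and $r'\neq r^{-1}$; its weight is $1-\frac{|p|+|q|}{|r|}$, where $|\cdot|$ is word length. A directed cycle is a closed directed walk (vertices and edges may repeat), its length is its number of edges, and its weight is the sum of the weights of its edges.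
   Formalization: The formal theorem also assumes that no relator of length 1 is a piece; without this the claim fails for ⟨x | x, x²⟩, where Γ(P) has no edges but a reduced sphere with faces x⁻¹, x⁻¹, x² violates τ'. *)

(* Defs.v *)
From mathcomp Require Import all_boot all_order all_algebra.

Set Implicit Arguments.
Unset Strict Implicit.
Unset Printing Implicit Defensive.

Import Order.TTheory GRing.Theory Num.Theory.
Local Open Scope ring_scope.

(** * Words and presentations *)

(* [(x, false)] stands for the generator x and [(x, true)] for its inverse. *)
Definition letter (X : Type) : Type := (X * bool)%type.
Definition word (X : Type) : Type := seq (letter X).

Definition linv X (a : letter X) : letter X := (a.1, ~~ a.2).
Definition winv X (w : word X) : word X := rev (map (@linv X) w).

Definition freely_reduced X (w : word X) : Prop :=
  forall (s t : word X) (a : letter X), w <> s ++ a :: linv a :: t.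

Definition cyclically_reduced X (w : word X) : Prop :=
  forall n : nat, freely_reduced (rot n w).

Record presentation (X : Type) := Presentation {
  relator : word X -> Prop;
  relator_cycred : forall r, relator r -> cyclically_reduced r;
  relator_indep : forall r r' n, relator r -> relator r' -> r <> r' ->
    r' <> rot n r /\ r' <> rot n (winv r) }.

Section Presentation.
Variables (X : Type) (P : presentation X).

(* The set R^*. *)
Definition Rstar (w : word X) : Prop :=
  exists r n, relator P r /\ (w = rot n r \/ w = rot n (winv r)).

Definition piece (p : word X) : Prop :=
  p <> [::] /\
  exists a b : word X, [/\ Rstar (p ++ a), Rstar (p ++ b) & p ++ a <> p ++ b].

End Presentation.

(** * Cell structures on the sphere and diagrams *)

(* A combinatorial cell structure on the oriented 2-sphere, encoded by its
   darts (oriented edges).  A dart starts at its origin; [vnext] rotates a dart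
   about its origin, [einv] reverses it, and [fnext d], the dart following [d]
   along the boundary of the face on a fixed side of [d], turns at the end of
   [d].  Vertices, edges and faces are the orbits of [vnext], [einv] and
   [fnext].  A finite connected structure of this kind is a cell structure on a
   closed oriented surface, which is the sphere exactly when V + F = E + 2.
   The only cell structure this leaves out is the one with no edges (one vertex
   and one face). *)
Record sphere_map := SphereMap {
  dart :> finType;
  vnext : dart -> dart;
  einv : dart -> dart;
  vnext_inj : injective vnext;
  einvK : involutive einv;
  einv_neq : forall d, einv d != d;
  sphere_connected :
    forall d d', connect (relU (frel vnext) (frel einv)) d d';
  sphere_euler :
    (fcard vnext predT + fcard (vnext \o einv) predT
     = fcard einv predT + 2)%N }.

Definition fnext (S : sphere_map) (d : S) : S := vnext (einv d).

(* The label of the boundary of the face of [d], read from the origin of [d]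
   and traversing [d] first. *)
Definition face_label X (S : sphere_map) (lab : S -> letter X) (d : S) :
  word X := map lab (orbit (@fnext S) d).

(* A combinatorial map to the standard 2-complex of P is given by the labels of
   the darts; since distinct relators are not cyclic permutations of each other
   up to inversion, the label of a face determines the 2-cell it is mapped to.
   [removed d] means that the face of [d] is one of the open 2-cells taken out
   of the sphere. *)
Record diagram X (P : presentation X) := Diagram {
  dmap :> sphere_map;
  removed : pred dmap;
  label : dmap -> letter X;
  removed_fnext : forall d, removed (fnext d) = removed d;
  label_einv : forall d, label (einv d) = linv (label d);
  label_face : forall d, ~~ removed d -> Rstar P (face_label label d) }.

Section Diagram.
Variables (X : Type) (P : presentation X) (M : diagram P).
Implicit Types d v : M.

(* The edge of [d] separates the face of [d] from that of [einv d].  The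
   boundary of the latter in its own orientation, read from the end of
   [einv d], traverses [einv d] last; its inverse is therefore the label in the
   opposite orientation that traverses [d] first. *)
Definition reducible : Prop :=
  exists d,
    [/\ ~~ removed d, ~~ removed (einv d),
        ~~ fconnect (@fnext M) d (einv d) &
        face_label (@label _ _ M) d
          = winv (face_label (@label _ _ M) (fnext (einv d)))].

Definition reduced : Prop := ~ reducible.

(* A vertex is represented by any dart [v] issued from it. *)
Definition degree v : nat := order (@vnext M) v.

Definition interior v : bool :=
  [forall d, fconnect (@vnext M) v d ==> ~~ removed d].

(* The vertices that are removed by merging their two incident edges. *)
Definition smooth v : bool := interior v && (degree v == 2).

(* The number of original edges in the merged edge that starts with the dart
   [d] at a vertex that is not smooth: through a smooth vertex the chain of
   edges continues along [fnext]. *)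
Definition edge_length d : nat :=
  (find (fun e : M => ~~ smooth (fnext e)) (orbit (@fnext M) d)).+1.

Definition relator_length d : nat := size (face_label (@label _ _ M) d).

(* The corners at [v] are indexed by the darts [d] issued from [v]: the corner
   of [d] lies in the face of [d], between the edges of [d] and of the
   preceding dart [finv vnext d]. *)
Definition dF v : rat :=
  \sum_(d | fconnect (@vnext M) v d)
    (edge_length d + edge_length (finv (@vnext M) d))%:R
      / (relator_length d)%:R.

End Diagram.

Definition tau' X (P : presentation X) : Prop :=
  forall (M : diagram P), reduced M ->
  forall v : M, interior v -> degree v <> 2%N ->
    dF v <= (degree v)%:R - 2.

Definition tau'_lt X (P : presentation X) : Prop :=
  forall (M : diagram P), reduced M ->
  forall v : M, interior v -> degree v <> 2%N ->
    dF v < (degree v)%:R - 2.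

(** * The weighted directed graph Gamma(P) *)

Record Gamma_vertex X (P : presentation X) := GammaVertex {
  g_rel : word X;
  g_p : word X;
  g_q : word X;
  g_relP : Rstar P g_rel;
  g_pP : piece P g_p;
  g_qP : piece P g_q;
  g_split : exists s : word X, g_rel = g_q ++ s ++ g_p }.

Section Gamma.
Variables (X : Type) (P : presentation X).
Implicit Types g : Gamma_vertex P.

Definition Gamma_edge g g' : Prop :=
  g_p g' = winv (g_q g) /\ g_rel g' <> winv (g_rel g).

(* The weight of an edge depends only on its source [g]. *)
Definition Gamma_weight g : rat :=
  1 - (size (g_p g) + size (g_q g))%:R / (size (g_rel g))%:R.

(* A directed cycle of length n is a closed walk indexed cyclically by 'I_n. *)
Definition directed_cycle n (c : 'I_n -> Gamma_vertex P) : Prop :=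
  forall i : 'I_n, Gamma_edge (c i) (c (ordS i)).

Definition cycle_weight n (c : 'I_n -> Gamma_vertex P) : rat :=
  \sum_(i < n) Gamma_weight (c i).

End Gamma.

(* Main.v *)
Require Import Defs.
From mathcomp Require Import all_boot all_order all_algebra.
From mathcomp Require Import zify lra.
Import Order.TTheory GRing.Theory Num.Theory.
Local Open Scope ring_scope.

(** Directed cycles of [Gamma(P)] of length [n >= 3] describe the neighbourhoods
    of interior vertices of degree [n] in reduced diagrams: the vertices of the
    cycle are the corners, and [cycle_weight c = degree v - dF v].  Both
    equivalences follow.

    From vertices to cycles ([interior_cycle]).  Let [v] be an interior vertex
    of a reduced diagram whose degree is not 2; it is not 1 either, because a
    vertex of degree 1 makes the label of a face non-reduced.  A merged edge at
    [v] is read, in opposite directions, by the faces on its two sides, so its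
    label is a common prefix of an element [r] of [R^*] and of the inverse of an
    element [r'] of [R^*].  These two words differ: if the two sides lie in
    different faces because the diagram is reduced, and if they lie in the same
    face because [r'] is then a rotation of [r], and a nonempty cyclically
    reduced word is never a rotation of its own inverse
    ([cycred_neq_winv_rot]).  So the labels of the edges are pieces.  The face
    of a corner has label [q s p], with [q] the label of the edge leaving the
    corner and [p] that of the edge entering it, unless these two edges overlap.
    They can only do so when they are one and the same edge, running around the
    whole face, and then a relator is a piece.  This is excluded by hypothesis
    if its length is 1, and by a cycle of weight less than 2 otherwise
    ([relator_not_piece]).

    From cycles to vertices ([cycle_diagram]).  Given a cycle with vertices
    [(r_i, p_i, q_i)], write [r_i = q_i s_i p_i] and glue [n] polygons with
    boundaries [r_i] around a common vertex, identifying the side [q_i] of the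
    polygon [i] with the side [p_(i+1) = q_i^-1] of the polygon [i+1].  The
    result is a disk bounded by the words [s_i], or a sphere if all of them are
    empty.  The condition [r_(i+1) <> r_i^-1] on the edges of [Gamma(P)] says
    that this diagram is reduced.  The spokes [q_i] are merged edges: their
    inner vertices have degree 2, and their ends either lie on the boundary or,
    in a sphere, coincide in a single vertex of degree [n >= 3].  The main work
    is to show that the gluing is a sphere, that is, to count its vertices,
    edges and faces ([wheel_euler]). *)

Set Implicit Arguments.
Unset Strict Implicit.
Unset Printing Implicit Defensive.

(** * Words, relators and pieces *)

Section Words.
Variable X : Type.
Implicit Types (a : letter X) (u v w : word X).

Lemma linvK : involutive (@linv X).
Proof. by case=> x b; rewrite /linv /= negbK. Qed.

Lemma linv_neq a : linv a <> a.
Proof. by case: a => x [] []. Qed.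

Lemma winvK : involutive (@winv X).
Proof. by move=> w; rewrite /winv map_rev revK (mapK linvK). Qed.

Lemma winv_inj : injective (@winv X).
Proof. exact: (inv_inj winvK). Qed.

Lemma size_winv w : size (winv w) = size w.
Proof. by rewrite size_rev size_map. Qed.

Lemma winv_cat u v : winv (u ++ v) = winv v ++ winv u.
Proof. by rewrite /winv map_cat rev_cat. Qed.

Lemma winv_rot n w : winv (rot n w) = rot (size w - n) (winv w).
Proof. by rewrite /winv map_rot rev_rot /rotr size_rev size_map. Qed.

Lemma nth_winv a w k :
  (k < size w)%N -> nth a (winv w) k = linv (nth a w (size w - k.+1)).
Proof.
move=> kw; rewrite /winv nth_rev ?size_map //.
by rewrite (nth_map a) //; lia.
Qed.

Lemma cat_cancel_l u v w : u ++ v = u ++ w -> v = w.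
Proof. by move/(congr1 (drop (size u))); rewrite !drop_size_cat. Qed.

Lemma cat_cancel_r u v w : v ++ u = w ++ u -> v = w.
Proof.
by move/(congr1 rev); rewrite !rev_cat => /cat_cancel_l/(congr1 rev); rewrite !revK.
Qed.

Lemma freely_reduced_infix u v w :
  freely_reduced (u ++ v ++ w) -> freely_reduced v.
Proof.
move=> red s t a eqv; apply: (red (u ++ s) (t ++ w) a).
by rewrite eqv -!catA.
Qed.

Lemma freely_reduced_winv w : freely_reduced w -> freely_reduced (winv w).
Proof.
move=> red s t a /(congr1 (@winv X)); rewrite winvK winv_cat /winv /= !rev_cons.
rewrite linvK -!cats1 -!catA /=; exact: red.
Qed.

Lemma cyclically_reduced_rot n w :
  cyclically_reduced w -> cyclically_reduced (rot n w).
Proof. by move=> red m; rewrite rot_rot_add; apply: red. Qed.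

Lemma cyclically_reduced_winv w :
  cyclically_reduced w -> cyclically_reduced (winv w).
Proof.
move=> red m; case: (leqP m (size w)) => mw.
  rewrite -(subKn mw) -winv_rot; apply: freely_reduced_winv; exact: red.
rewrite rot_oversize ?size_winv 1?ltnW //.
by apply: freely_reduced_winv; rewrite -(rot0 w).
Qed.

(** Cancelling the outer letters of a word equal to its inverse leaves a shorter
    such word; the process ends at a letter equal to its inverse or at a
    cancelling pair. *)
Lemma self_inverse_nil w : freely_reduced w -> winv w = w -> w = [::].
Proof.
have [n] := ubnP (size w); elim: n w => // n IHn [//|a w] size_w red.
case/lastP: w => [|w b] in size_w red *.
  by rewrite /winv /= => -[] /linv_neq.
rewrite -rcons_cons /winv map_rcons rev_rcons /= rev_cons -rcons_cons => -[eqb].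
move/rcons_inj => [eqw eqa].
have w0 : w = [::].
  apply: IHn => //; first by move: size_w; rewrite /= size_rcons; lia.
  by apply: (@freely_reduced_infix [:: a] _ [:: b]); rewrite /= cats1.
by case: (red [::] [::] a); rewrite w0 -eqb linvK -eqa.
Qed.

(** If [w = u ++ v] is the inverse of [v ++ u], then [u] and [v] are both equal
    to their own inverses. *)
Lemma cycred_neq_winv_rot n w :
  cyclically_reduced w -> w <> [::] -> w <> winv (rot n w).
Proof.
move=> red w0 eqw; have redw := red 0%N; rewrite rot0 in redw.
have eqsz : size (take n w) = size (winv (take n w)) by rewrite size_winv.
have := eqw; rewrite /rot winv_cat -{1}(cat_take_drop n w) => eqtd.
have eqt : winv (take n w) = take n w.
  move/(congr1 (take (size (take n w)))): (eqtd).
  by rewrite take_size_cat // take_size_cat.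
have eqd : winv (drop n w) = drop n w.
  by move: eqtd; rewrite eqt => /cat_cancel_l.
apply: w0; rewrite -(cat_take_drop n w).
have -> : take n w = [::].
  apply: self_inverse_nil => //.
  by apply: (@freely_reduced_infix [::] _ (drop n w)); rewrite cat_take_drop.
apply: self_inverse_nil => //.
by apply: (@freely_reduced_infix (take n w) _ [::]); rewrite cats0 cat_take_drop.
Qed.

End Words.

Section Pieces.
Variables (X : Type) (P : presentation X).
Implicit Types (u v w p r : word X).

Lemma Rstar_rot n w : Rstar P w -> Rstar P (rot n w).
Proof.
move=> [r [m [rP [->|->]]]]; rewrite rot_rot_add; exists r;
  [exists (rot_add r m n)|exists (rot_add (winv r) m n)]; split; auto.
Qed.

Lemma Rstar_winv w : Rstar P w -> Rstar P (winv w).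
Proof.
move=> [r [m [rP [->|->]]]]; rewrite winv_rot ?winvK; apply: Rstar_rot;
  exists r, 0%N; rewrite !rot0; auto.
Qed.

Lemma Rstar_catC u v : Rstar P (u ++ v) -> Rstar P (v ++ u).
Proof. by move/(@Rstar_rot (size u)); rewrite rot_size_cat. Qed.

Lemma Rstar_cycred w : Rstar P w -> cyclically_reduced w.
Proof.
move=> [r [m [/relator_cycred red [->|->]]]]; apply: cyclically_reduced_rot => //.
exact: cyclically_reduced_winv.
Qed.

Lemma piece_infix u p v : p <> [::] -> piece P (u ++ p ++ v) -> piece P p.
Proof.
move=> p0 [_ [a [b [aP bP ab]]]]; split=> //.
exists (v ++ a ++ u), (v ++ b ++ u); split.
- by move: aP; rewrite -!catA => /Rstar_catC; rewrite -!catA.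
- by move: bP; rewrite -!catA => /Rstar_catC; rewrite -!catA.
by move=> /cat_cancel_l/cat_cancel_l/cat_cancel_r eqab; apply: ab; rewrite eqab.
Qed.

Lemma piece_winv p : piece P p -> piece P (winv p).
Proof.
move=> [p0 [a [b [aP bP ab]]]]; split.
  by move/(congr1 size); rewrite size_winv => /size0nil.
exists (winv a), (winv b); split.
- by rewrite -winv_cat; apply: Rstar_winv; apply: Rstar_catC.
- by rewrite -winv_cat; apply: Rstar_winv; apply: Rstar_catC.
by move=> /cat_cancel_l/winv_inj eqab; apply: ab; rewrite eqab.
Qed.

Lemma piece_winvE p : piece P (winv p) <-> piece P p.
Proof. by split=> [/piece_winv|]; [rewrite winvK | exact: piece_winv]. Qed.

(** An element [r] of [R^*] which is a piece is a proper prefix of some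
    [r ++ t] in [R^*].  If [|r| >= 2], write [r = x y]: a disk made of faces [r]
    and [(r t)^-1] sharing the path [r] has an interior vertex of degree 2 where
    [x] and [y] meet.  Its two corners form a 2-cycle of [Gamma(P)] of weight
    [1 - |r| / |r t| < 1], so running through it twice contradicts the
    hypothesis on cycles. *)
Lemma relator_not_piece :
  (forall r, relator P r -> size r = 1%N -> ~ piece P r) ->
  (forall (n : nat) (c : 'I_n -> Gamma_vertex P),
     (3 <= n)%N -> directed_cycle c -> 2 <= cycle_weight c) ->
  forall r, Rstar P r -> ~ piece P r.
Proof.
move=> Hone Hcyc r rP rpc.
have [size1|] := eqVneq (size r) 1%N.
  have rot1 m w : size w = 1%N -> rot m w = w :> word X.
    by case: w => [|x []] //; case: m.
  have [r0 [m [r0P [] eqr]]] := rP; rewrite eqr size_rot in size1;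
    rewrite eqr rot1 // in rpc; first exact: Hone rpc.
  by apply: Hone r0P _ _; [rewrite -size_winv | apply/piece_winvE].
have [r0 [a [b [aP bP ab]]]] := rpc.
(* The two distinct extensions of [r] are not both empty. *)
have {a b aP bP ab} [t t0 tP] : exists2 t, t <> [::] & Rstar P (r ++ t).
  case: a aP ab => [|x a] aP ab; last by exists (x :: a).
  by exists b => // b0; apply: ab; rewrite b0.
case: r r0 rP rpc tP => // x y _ rP rpc tP size_r.
have y0 : y <> [::] by move=> y0; move: size_r; rewrite y0.
have x_pc : piece P [:: x] by apply: (@piece_infix [::] _ y).
have y_pc : piece P y by apply: (@piece_infix [:: x] _ [::]); rewrite ?cats0.
have r1P : Rstar P (y ++ [:: x]) by apply: Rstar_catC.
have r2P : Rstar P (winv (y ++ t ++ [:: x])).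
  by apply: Rstar_winv; rewrite catA; apply: Rstar_catC.
have split1 : exists s, y ++ [:: x] = y ++ s ++ [:: x] by exists [::].
have split2 : exists s, winv (y ++ t ++ [:: x]) = winv [:: x] ++ s ++ winv y.
  by exists (winv t); rewrite !winv_cat !catA.
pose g1 := GammaVertex r1P x_pc y_pc split1.
pose g2 := GammaVertex r2P (piece_winv y_pc) (piece_winv x_pc) split2.
have size_t : (0 < size t)%N by case: (t) t0.
have size_y : (0 < size y)%N by case: (y) y0.
have e12 : Gamma_edge g1 g2.
  split=> //= /winv_inj /(congr1 size); rewrite !size_cat /=; lia.
have e21 : Gamma_edge g2 g1.
  split=> /=; first by rewrite winvK.
  by rewrite winvK => /(congr1 size); rewrite !size_cat /=; lia.
pose c (i : 'I_4) := if odd i then g2 else g1.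
have := Hcyc 4%N c isT; rewrite leNgt => /(_ _)/negP; apply.
  by case=> [[|[|[|[|i]]]]] // lti; rewrite /c /=.
rewrite /cycle_weight !big_ord_recr big_ord0 /= /c /= add0r /Gamma_weight /=.
rewrite !size_winv !size_cat /=.
set m := size y in size_y *; set l := size t in size_t *.
have -> : ((1 + m)%:R / (m + 1)%:R : rat) = 1.
  by rewrite addnC divff // pnatr_eq0; lia.
have : 0 < ((m + 1)%:R / (m + (l + 1))%:R : rat).
  by apply: divr_gt0; rewrite ltr0n; lia.
lra.
Qed.

End Pieces.

(** * Orbits of finite maps *)

Section Orbits.
Variables (T : finType) (f : T -> T).

Lemma iter_inj k : injective f -> injective (iter k f).
Proof. by move=> injf; elim: k => [|k IHk] x y //= /injf/IHk. Qed.

Lemma iter_lt_order_inj x i j :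
  (i < order f x)%N -> (j < order f x)%N -> iter i f x = iter j f x -> i = j.
Proof. by move=> lti ltj eqij; rewrite -(findex_iter lti) eqij findex_iter. Qed.

Hypothesis injf : injective f.

Lemma fconnect_order x y : fconnect f x y -> order f y = order f x.
Proof.
move=> cxy; apply: eq_card => z.
by rewrite -!topredE /= (same_connect (fconnect_sym injf) cxy).
Qed.

Lemma orbit_fconnect x y :
  fconnect f x y -> orbit f y = rot (findex f x y) (orbit f x).
Proof.
move=> cxy; apply: orbitE; rewrite -?fconnect_orbit //.
exact: cycle_orbit.
Qed.

Lemma sum_fconnect (R : nmodType) (F : T -> R) x :
  \sum_(y | fconnect f x y) F y = \sum_(i < order f x) F (iter i f x).
Proof.
rewrite (eq_bigl [in orbit f x]) => [|y]; last by rewrite fconnect_orbit.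
rewrite -big_uniq ?orbit_uniq //= (big_nth x) size_orbit big_mkord.
by apply: eq_bigr => i _; rewrite nth_traject.
Qed.

Lemma order_first_return x N : (0 < N)%N ->
    iter N f x = x -> (forall k, (0 < k < N)%N -> iter k f x != x) ->
  order f x = N.
Proof.
move=> N_gt0 iterN iterk; have [lt|gt|//] := ltngtP (order f x) N.
  by have := iterk (order f x); rewrite order_gt0 lt iter_order // eqxx => /(_ isT).
by have := findex_iter gt; rewrite iterN findex0 => N0; rewrite -N0 in N_gt0.
Qed.

End Orbits.

(** Orbits are the fibres of an invariant [h] as soon as every point is in the
    orbit of the representative [rep] of its fibre. *)
Lemma fcard_invariant (T U : finType) (f : T -> T) (h : T -> U) (rep : U -> T) :
    injective f -> (forall x, h (f x) = h x) ->
    (forall x, fconnect f x (rep (h x))) -> cancel rep h ->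
  fcard f predT = #|U|.
Proof.
move=> injf hf con repK.
have hcon x y : fconnect f x y -> h x = h y.
  by move=> /iter_findex <-; elim: (findex f x y) => //= k ->; rewrite hf.
rewrite -(card_in_imset (f := fun u => froot f (rep u))) => [|u v _ _ eq_uv].
  apply: eq_card => x; rewrite !inE andbT; apply/idP/imsetP => [/eqP rx|[u _ ->]].
    exists (h x) => //; rewrite -{1}rx.
    by apply/eqP; rewrite (root_connect (fconnect_sym injf)).
  exact: roots_root (fconnect_sym injf) _.
rewrite -(repK u) -(repK v); apply: hcon.
by rewrite -(root_connect (fconnect_sym injf)); apply/eqP.
Qed.

Lemma fcard_involution (T : finType) (f : T -> T) :
  involutive f -> (forall x, f x != x) -> (fcard f predT * 2 = #|T|)%N.
Proof.
move=> fK f_neq; rewrite (fcard_order_set (inv_inj fK)) //.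
apply/subsetP => x _; rewrite inE; apply/eqP.
apply: (@order_cycle _ f [:: x; f x]) => /=; rewrite ?fK ?eqxx //.
  by rewrite !inE eq_sym f_neq.
by rewrite inE eqxx.
Qed.

Section CyclicOrder.
Variables (n : nat).
Implicit Types i j : 'I_n.

Lemma iter_ordS k i : iter k (@ordS n) i = ((i + k) %% n)%N :> nat.
Proof.
elim: k => [|k IHk] /=; first by rewrite addn0 modn_small.
by rewrite IHk -addn1 modnDml addn1 addnS.
Qed.

Lemma iter_ordS_ex i j : exists k, iter k (@ordS n) i = j.
Proof.
exists (n - i + j)%N; apply: val_inj; rewrite /= iter_ordS addnA subnKC 1?ltnW //.
by rewrite modnDl modn_small.
Qed.

Lemma iter_ord_pred_ex i j : exists k, iter k (@ord_pred n) i = j.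
Proof.
have [k <-] := iter_ordS_ex j i; exists k.
by elim: k {i} j => //= k IHk j; rewrite -iterS iterSr [iter _ _ (_ _)]/= ordSK.
Qed.

Lemma ord_pred2_neq i : (2 < n)%N -> ord_pred (ord_pred i) != i.
Proof.
move=> gt2; apply: contraTneq gt2 => eqi.
have: val (ordS (ordS i)) = i by rewrite -[in LHS]eqi !ord_predK.
have := iter_ordS 2 i; rewrite /= => -> eqm; have lti := ltn_ord i.
rewrite -leqNgt; have [lt|le] := ltnP (i + 2) n.
  by move: eqm; rewrite modn_small //; lia.
have := divn_eq (i + 2) n; rewrite eqm; case: (_ %/ _)%N => [|[|k]]; nia.
Qed.

End CyclicOrder.

(** * From interior vertices to cycles *)

Section Edges.
Variables (X : Type) (P : presentation X) (M : diagram P).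
Implicit Types (d v : M) (k : nat).
Local Notation vn := (@vnext M).
Local Notation fn := (@fnext M).
Local Notation face d := (face_label (@label _ _ M) d).

Lemma fnext_inj : injective fn.
Proof. by move=> d d' /vnext_inj/(inv_inj (@einvK M)). Qed.

Lemma fnext_einv d : fn (einv d) = vn d.
Proof. by rewrite /fnext einvK. Qed.

Lemma removed_einv d : removed (einv d) = removed (vn d).
Proof. by rewrite -removed_fnext fnext_einv. Qed.

Lemma interior_fconnect v d : fconnect vn v d -> interior d = interior v.
Proof.
move=> cvd; apply: eq_forallb => e.
by rewrite (same_connect (fconnect_sym (@vnext_inj M)) cvd).
Qed.

Lemma smooth_fconnect v d : fconnect vn v d -> smooth d = smooth v.
Proof.
move=> cvd; rewrite /smooth (interior_fconnect cvd) /degree.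
by rewrite (fconnect_order (@vnext_inj M) cvd).
Qed.

Lemma smooth_vnext d : smooth (vn d) = smooth d.
Proof. exact/smooth_fconnect/fconnect1. Qed.

Lemma interior_removed v d : interior v -> fconnect vn v d -> ~~ removed d.
Proof. by move/forallP/(_ d)/implyP. Qed.

Lemma size_face d : size (face d) = order fn d.
Proof. by rewrite size_map size_orbit. Qed.

Lemma nth_face a d k :
  (k < order fn d)%N -> nth a (face d) k = label (iter k fn d).
Proof. by move=> ltk; rewrite (nth_map d) ?size_orbit // nth_traject. Qed.

Lemma face_neq_nil d : face d <> [::].
Proof.
move/(congr1 size); rewrite size_face /= => ord0.
by have := order_gt0 fn d; rewrite ord0.
Qed.

(** The search in [edge_length] succeeds because the orbit of [d] comes back to
    [d] itself, so the default value of [find] is never met. *)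
Lemma edge_lengthP d : ~~ smooth d ->
  [/\ (0 < edge_length d <= order fn d)%N,
      forall k, (0 < k < edge_length d)%N -> smooth (iter k fn d)
    & ~~ smooth (iter (edge_length d) fn d)].
Proof.
move=> nsd; rewrite /edge_length; set a := (fun e : M => ~~ smooth (fn e)).
have has_a : has a (orbit fn d).
  apply/hasP; exists (finv fn d); first by rewrite -fconnect_orbit fconnect_finv.
  by rewrite /a f_finv //; exact: fnext_inj.
have := has_a; rewrite has_find size_orbit => ltL.
split=> // [[//|k] /andP[_ ltk]|].
  have /= := before_find d ltk.
  by rewrite nth_traject ?(leq_trans _ ltL) ?ltnS 1?ltnW // /a -iterS => /negbFE.
by have /= := nth_find d has_a; rewrite nth_traject.
Qed.

Lemma edge_length_eq d L : (0 < L <= order fn d)%N ->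
    (forall k, (0 < k < L)%N -> smooth (iter k fn d)) ->
  ~~ smooth (iter L fn d) -> edge_length d = L.
Proof.
case: L => [//|L] /= leL smk nsL; congr (_.+1).
set a := (fun e : M => ~~ smooth (fn e)).
have before k : (k < L)%N -> a (nth d (orbit fn d) k) = false.
  move=> ltk; rewrite nth_traject ?(ltn_trans ltk) // /a -iterS.
  by apply/negbF; apply: smk.
have atL : a (nth d (orbit fn d) L) by rewrite nth_traject.
have [lt|gt|//] := ltngtP (find a (orbit fn d)) L.
  by have := before _ lt; rewrite nth_find // has_find size_orbit; lia.
by have := before_find d gt; rewrite atL.
Qed.

Definition edge_word d := take (edge_length d) (face d).

Lemma size_edge_word d : ~~ smooth d -> size (edge_word d) = edge_length d.
Proof.
by case/edge_lengthP=> /andP[_ leL] _ _; rewrite size_takel ?size_face.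
Qed.

(** At a vertex of degree 2, turning twice is the identity: the face on the other
    side of an edge follows the same chain of edges backwards. *)
Lemma fnext_einv_smooth d : smooth (fn d) -> fn (einv (fn d)) = einv d.
Proof.
rewrite fnext_einv smooth_vnext => /andP[_ /eqP deg2].
by rewrite -[RHS](iter_order (@vnext_inj M)) -/(degree _) deg2.
Qed.

Lemma iter_fnext_einv d k :
    (forall j, (0 < j <= k)%N -> smooth (iter j fn d)) ->
  iter k fn (einv (iter k fn d)) = einv d.
Proof.
elim: k => // k IHk smj; rewrite iterSr /= fnext_einv_smooth ?IHk //.
  by move=> j /andP[j0 jk]; apply: smj; lia.
by apply: (smj k.+1); lia.
Qed.

(** The face on the other side of the merged edge of [d] traverses it backwards,
    just before the corner of [vnext d]; hence its label, read from that corner,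
    ends with the inverse of the label of the edge. *)
Lemma edge_reverse d : ~~ smooth d ->
  [/\ (edge_length d <= order fn (vn d))%N,
      forall k, (order fn (vn d) - edge_length d < k < order fn (vn d))%N ->
        smooth (iter k fn (vn d))
    & face (vn d) = take (order fn (vn d) - edge_length d) (face (vn d))
                    ++ winv (edge_word d)].
Proof.
move=> nsd; have [/andP[L_gt0 leL] smk nsL] := edge_lengthP nsd.
set L := edge_length d in L_gt0 leL smk nsL *; set N := order fn (vn d).
have N_gt0 : (0 < N)%N by exact: order_gt0.
have back k : (k < L)%N -> iter k.+1 fn (einv (iter k fn d)) = vn d.
  move=> ltk; rewrite iterS iter_fnext_einv ?fnext_einv // => j /andP[j0 jk].
  by apply: smk; lia.
have back_order k : (k < L)%N -> order fn (einv (iter k fn d)) = N.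
  move=> ltk; rewrite /N -(back k ltk); apply/esym/fconnect_order.
    exact: fnext_inj.
  exact: fconnect_iter.
(* If the chain were longer than the face on the other side, it would be
   periodic, although its [L <= order fn d] darts are distinct. *)
have leLN : (L <= N)%N.
  rewrite leqNgt; apply/negP => ltN.
  have ltL1 : (L.-1 < L)%N by lia.
  have ltL2 : (L.-1 - N < L)%N by lia.
  have: iter L fn (einv (iter L.-1 fn d))
        = iter L fn (einv (iter (L.-1 - N) fn d)).
    have := back _ ltL1; rewrite prednK // => ->.
    have -> : L = (N + (L.-1 - N).+1)%N by lia.
    rewrite iterD [in RHS](_ : (N + (L.-1 - N).+1).-1 - N = L.-1 - N)%N; last lia.
    by rewrite back // [RHS]iter_order //; exact: fnext_inj.
  move/(iter_inj fnext_inj)/(inv_inj (@einvK M)).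
  by move/(iter_lt_order_inj (leq_trans ltL1 leL) (leq_trans ltL2 leL)); lia.
have fwd k : (k < L)%N -> iter (N - k.+1) fn (vn d) = einv (iter k fn d).
  move=> ltk; apply: (iter_inj (k := k.+1) fnext_inj).
  rewrite back // -iterD subnKC; last lia.
  by rewrite iter_order //; exact: fnext_inj.
split=> // [k /andP[ltk1 ltk2]|].
  have -> : k = (N - (N - k).-1.+1)%N by lia.
  rewrite fwd; last lia.
  by rewrite -smooth_vnext -/(fn _) -iterS; apply: smk; lia.
rewrite -{1}(cat_take_drop (N - L) (face (vn d))); congr (_ ++ _).
have size_w := size_edge_word nsd; rewrite -/L in size_w.
apply: (@eq_from_nth _ (label d)); rewrite size_drop size_face.
  by rewrite size_winv size_w; lia.
move=> k ltk; rewrite nth_drop nth_face; last by rewrite -/N in ltk *; lia.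
rewrite nth_winv size_w; last lia.
rewrite nth_take; last by rewrite -/L; lia.
rewrite nth_face; last lia.
rewrite -label_einv -fwd; last lia.
by congr (label (iter _ _ _)); rewrite -/N in ltk; lia.
Qed.

Hypothesis redM : reduced M.

(** When both sides of the edge lie in the same face, reducedness says nothing:
    there, a cyclically reduced word is not a rotation of its own inverse. *)
Lemma face_across d : ~~ removed d -> ~~ removed (vn d) ->
  face d <> winv (face (vn d)).
Proof.
move=> rd rvd; case: (boolP (fconnect fn d (einv d))) => [|ncon eqf].
  move/(connect_trans)/(_ (fconnect1 fn _)); rewrite fnext_einv => con.
  rewrite {2}/face_label (orbit_fconnect fnext_inj con) map_rot.
  apply: cycred_neq_winv_rot; last exact: face_neq_nil.
  exact/Rstar_cycred/label_face.
by apply: redM; exists d; rewrite fnext_einv removed_einv.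
Qed.

Lemma edge_word_piece d :
  ~~ smooth d -> ~~ removed d -> ~~ removed (vn d) -> piece P (edge_word d).
Proof.
move=> nsd rd rvd; split.
  have [/andP[L0 _] _ _] := edge_lengthP nsd.
  by move/(congr1 size); rewrite size_edge_word //= => L1; rewrite L1 in L0.
have [_ _ eqf] := edge_reverse nsd.
have eqd : face d = edge_word d ++ drop (edge_length d) (face d).
  by rewrite cat_take_drop.
have eqw : winv (face (vn d)) = edge_word d
    ++ winv (take (order fn (vn d) - edge_length d) (face (vn d))).
  by rewrite {1}eqf winv_cat winvK.
have neq := face_across rd rvd.
exists (drop (edge_length d) (face d)),
  (winv (take (order fn (vn d) - edge_length d) (face (vn d)))).
rewrite -eqd -eqw; split=> //; first exact: label_face.
exact/Rstar_winv/label_face.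
Qed.

Hypothesis no_piece : forall r, Rstar P r -> ~ piece P r.

(** Inner vertices of the edge entering a corner are smooth, and the end of the
    edge leaving it is not; so these edges can only overlap if the second one
    runs around the whole face, whose label is then a piece. *)
Lemma corner_split d : ~~ smooth d -> ~~ removed d -> ~~ removed (vn d) ->
    ~~ removed (vn (vn d)) ->
  exists s, face (vn d) = edge_word (vn d) ++ s ++ winv (edge_word d).
Proof.
move=> nsd rd rvd rvvd; have nsvd : ~~ smooth (vn d) by rewrite smooth_vnext.
have [leL sm eqf] := edge_reverse nsd.
have [/andP[L0 leL'] _ nsL'] := edge_lengthP nsvd.
set N := order fn (vn d) in leL sm eqf leL' *.
have neqL : edge_length (vn d) <> N.
  move=> eqL; apply: (@no_piece (face (vn d))); first exact: label_face.
  have := edge_word_piece nsvd rvd rvvd.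
  by rewrite /edge_word eqL /N -size_face take_size.
have leLL : (edge_length (vn d) <= N - edge_length d)%N.
  by rewrite leqNgt; apply: contra nsL' => lt; apply: sm; lia.
exists (drop (edge_length (vn d)) (take (N - edge_length d) (face (vn d)))).
rewrite catA {1}eqf; congr (_ ++ _).
by rewrite /edge_word -(take_takel _ leLL) cat_take_drop.
Qed.

(** Around a vertex of degree 1, a face runs along the edge and back. *)
Lemma interior_degree_neq1 v : interior v -> degree v <> 1%N.
Proof.
move=> intv deg1.
have vn_v : vn v = v.
  by rewrite -[RHS](iter_order (@vnext_inj M)) -/(degree _) deg1.
have rv : ~~ removed (einv v).
  by rewrite removed_einv vn_v (interior_removed intv) ?connect0.
have : freely_reduced (face (einv v)).
  by rewrite -(rot0 (face _)); exact: Rstar_cycred (label_face rv) 0%N.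
rewrite /face_label /orbit.
case eqn : (order fn (einv v)) (iter_order fnext_inj (einv v)) => [|[|n]] /=.
- by have := order_gt0 fn (einv v); rewrite eqn.
- by rewrite fnext_einv vn_v => eqv; have := einv_neq v; rewrite -eqv eqxx.
move=> _ /(_ [::] (map (@label _ _ M) (traject fn (fn (fn (einv v))) n))).
by move/(_ (label (einv v))); apply; rewrite /= fnext_einv vn_v label_einv linvK.
Qed.

(** The corners of [d] and [vnext d] share the edge of [d], which leaves the first
    one with label [q] and enters the second one with label [q^-1]; that the two
    words around this edge are not inverse to each other is [face_across]. *)
Lemma interior_cycle v : interior v -> degree v <> 2%N ->
  exists c : 'I_(degree v) -> Gamma_vertex P,
    [/\ (3 <= degree v)%N, directed_cycle c
      & cycle_weight c = (degree v)%:R - dF v].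
Proof.
move=> intv deg2; have deg1 := interior_degree_neq1 intv.
have deg0 : (0 < degree v)%N by exact: order_gt0.
have rem k : ~~ removed (iter k vn v).
  exact: interior_removed intv (fconnect_iter _ _ _).
have nsm k : ~~ smooth (iter k vn v).
  rewrite (smooth_fconnect (fconnect_iter _ k v)) /smooth intv /=.
  exact/eqP.
have injv := @vnext_inj M.
pose d (i : nat) := iter i vn v.
have vn_finv k : finv vn (d k) = iter (k + (degree v).-1) vn v.
  apply: (injv); rewrite (f_finv injv) /d -iterS -addnS prednK // iterD.
  by rewrite [iter (degree v) vn v](iter_order injv).
have /fin_all_exists[c cP] : forall i : 'I_(degree v), exists g : Gamma_vertex P,
    [/\ g_rel g = face (d i), g_q g = edge_word (d i)
      & g_p g = winv (edge_word (finv vn (d i)))].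
  move=> i; rewrite vn_finv.
  set b := iter _ vn v; have eqd : d i = vn b by rewrite /b -vn_finv (f_finv injv).
  have split_i : exists s, face (d i) = edge_word (d i) ++ s ++ winv (edge_word b).
    by rewrite eqd; apply: corner_split;
      [exact: nsm | exact: rem | exact: (rem _.+1) | exact: (rem _.+2)].
  have relP : Rstar P (face (d i)) by exact: label_face (rem i).
  have qP : piece P (edge_word (d i)).
    by apply: edge_word_piece; [exact: nsm | exact: rem | exact: (rem _.+1)].
  have pP : piece P (winv (edge_word b)).
    apply/piece_winv/edge_word_piece; [exact: nsm | exact: rem | exact: (rem _.+1)].
  by exists (GammaVertex relP pP qP split_i).
exists c; split; first by lia.
  move=> i; have [ri qi pi] := cP i; have [rj qj pj] := cP (ordS i).
  have eqd : d (ordS i) = vn (d i).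
    rewrite /d /= -iterS; have := ltn_ord i; rewrite leq_eqVlt => /predU1P[->|lti].
      by rewrite modnn [RHS](iter_order injv).
    by rewrite modn_small.
  split; first by rewrite pj qi eqd (finv_f injv).
  rewrite rj ri eqd => /(congr1 (@winv X)); rewrite winvK => /esym.
  by apply: face_across; [exact: rem | exact: (rem _.+1)].
rewrite /cycle_weight /Gamma_weight sumrB sumr_const card_ord; congr (_ - _).
rewrite /dF sum_fconnect; apply: eq_bigr => i _.
have [-> -> ->] := cP i.
have nsf : ~~ smooth (finv vn (d i)) by rewrite vn_finv.
rewrite size_winv (size_edge_word nsf) (size_edge_word (nsm i)) addnC.
by rewrite /relator_length /d.
Qed.

End Edges.

(** * Gluing polygons around a vertex into a sphere *)

(** Polygon [i] has [a i + s i + a (i-1)] sides.  Its first [a i] sides form a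
    spoke starting at the hub, which is glued to the last sides of polygon [i+1];
    the next [s i] sides form an arc of the rim; its last [a (i-1)] sides come
    back to the hub along the spoke of polygon [i-1]. *)
Section Wheel.
Variables (n : nat) (i0 : 'I_n) (a s : 'I_n -> nat).
Hypothesis a_gt0 : forall i, (0 < a i)%N.
Implicit Types (i j : 'I_n) (k l x : nat).

Definition perim i := (a i + s i + a (ord_pred i))%N.

Lemma perim_gt0 i : (0 < perim i)%N.
Proof. by rewrite /perim; have := a_gt0 i; lia. Qed.

(** The outside of the rim is a polygon with [rim_size] sides, running through
    the arcs in increasing order; [off i] is the position where the arc of [i]
    starts. *)
Definition rim_size := (\sum_(i < n) s i)%N.
Definition off k := (\sum_(i < n | i < k) s i)%N.

(** A dart is a side of a polygon or, on the right, a side of the outside. *)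
Definition wheel_dart : finType := ({i : 'I_n & 'I_(perim i)} + 'I_rim_size)%type.

(** [cell] and [rim] take their position in [nat], so that arithmetic on it needs
    no casts between ordinals; out of range, they return an arbitrary dart. *)
Definition cell i k : wheel_dart :=
  inl (Tagged (fun i => 'I_(perim i)) (insubd (Ordinal (perim_gt0 i)) k)).

Definition rim x : wheel_dart :=
  if insub x is Some b then inr (b : 'I_rim_size) else cell i0 0.

(** Gluing reverses orientation: positions count from opposite ends on the two
    sides of an edge.  In particular the outside runs through each arc from the
    end to the start that it has for its polygon. *)
Definition wheel_einv (d : wheel_dart) : wheel_dart :=
  match d with
  | inl t =>
    let i := tag t in let k : nat := tagged t in
    if (k < a i)%N then cell (ordS i) (perim (ordS i) - k.+1)
    else if (k < a i + s i)%N then rim (off i + (a i + s i - k.+1))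
    else cell (ord_pred i) (perim i - k.+1)
  | inr b =>
    cell (tagnat.sig1 b)
      (a (tagnat.sig1 b) + s (tagnat.sig1 b) - (tagnat.sig2 b).+1)
  end.

Definition wheel_fnext (d : wheel_dart) : wheel_dart :=
  match d with
  | inl t => inl (Tagged (fun i => 'I_(perim i)) (ordS (tagged t)))
  | inr b => inr (ordS b)
  end.

Definition wheel_vnext d := wheel_fnext (wheel_einv d).

Lemma val_cell i k :
  (k < perim i)%N -> val (insubd (Ordinal (perim_gt0 i)) k) = k.
Proof. by move=> ltk; rewrite val_insubd ltk. Qed.

Lemma cell_tag (t : {i : 'I_n & 'I_(perim i)}) :
  inl t = cell (tag t) (tagged t).
Proof.
case: t => i k; congr inl; congr existT; apply: val_inj => /=.
by rewrite val_insubd ltn_ord.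
Qed.

Lemma rimE (b : 'I_rim_size) : rim b = inr b.
Proof. by rewrite /rim valK. Qed.

Lemma off_rim i (j : 'I_(s i)) : (off i + j = tagnat.Rank i j)%N.
Proof. by rewrite tagnat.RankEsum. Qed.

Lemma off_lt i k : (k < s i)%N -> (off i + k < rim_size)%N.
Proof. by move=> ltk; rewrite (off_rim (Ordinal ltk)). Qed.

Lemma wheel_dart_ind (Q : wheel_dart -> Prop) :
    (forall i k, (k < perim i)%N -> Q (cell i k)) ->
    (forall i k, (k < s i)%N -> Q (rim (off i + k))) ->
  forall d, Q d.
Proof.
move=> Qcell Qrim [t|b]; first by rewrite cell_tag; apply: Qcell; exact: ltn_ord.
rewrite -rimE tagnat.rect; apply: Qrim; exact: ltn_ord.
Qed.

Lemma fnext_cell i k : (k < perim i)%N ->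
  wheel_fnext (cell i k) = cell i (k.+1 %% perim i).
Proof.
move=> ltk; congr inl; congr existT; apply: val_inj => /=.
by rewrite val_cell // val_cell // ltn_mod perim_gt0.
Qed.

Lemma fnext_cellS i k : (k.+1 < perim i)%N ->
  wheel_fnext (cell i k) = cell i k.+1.
Proof. by move=> ltk; rewrite fnext_cell ?modn_small // ltnW. Qed.

Lemma fnext_cell0 i : wheel_fnext (cell i (perim i).-1) = cell i 0.
Proof.
have p0 := perim_gt0 i.
by rewrite fnext_cell ?prednK // modnn.
Qed.

Lemma fnext_rim x : (x < rim_size)%N ->
  wheel_fnext (rim x) = rim (x.+1 %% rim_size).
Proof.
move=> ltx; rewrite -[x in LHS]/(val (Ordinal ltx)) rimE.
exact/esym/(rimE (ordS (Ordinal ltx))).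
Qed.

Lemma einv_spoke i k : (k < a i)%N ->
  wheel_einv (cell i k) = cell (ordS i) (perim (ordS i) - k.+1).
Proof. by move=> ltk; rewrite /= val_cell ?ltk // /perim; lia. Qed.

Lemma einv_rim i k : (k < s i)%N ->
  wheel_einv (rim (off i + k)) = cell i (a i + s i - k.+1).
Proof.
move=> ltk; rewrite (off_rim (Ordinal ltk)) rimE /=.
by rewrite tagnat.Rank2K /= tagnat.Rank1K.
Qed.

Lemma einv_cell_rim i k : (k < s i)%N ->
  wheel_einv (cell i (a i + s i - k.+1)) = rim (off i + k).
Proof.
move=> ltk; rewrite /= val_cell; last by rewrite /perim; lia.
rewrite ifN; last by lia.
by rewrite ifT; [congr (rim (_ + _)); lia | lia].
Qed.

Lemma einv_spoke_back i k : (k < a (ord_pred i))%N ->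
  wheel_einv (cell i (perim i - k.+1)) = cell (ord_pred i) k.
Proof.
move=> ltk; rewrite /= val_cell; last by rewrite /perim; lia.
have ltp : (k < perim i)%N by rewrite /perim; lia.
rewrite ifN; last by rewrite /perim; lia.
rewrite ifN; last by rewrite /perim; lia.
by congr cell; lia.
Qed.

(** The sides of the polygons sorted by what they are glued to, each counted from
    the end that makes [wheel_einv] simplest. *)
Lemma wheel_side_ind (Q : wheel_dart -> Prop) :
    (forall i k, (k < a i)%N -> Q (cell i k)) ->
    (forall i k, (k < s i)%N -> Q (cell i (a i + s i - k.+1))) ->
    (forall i k, (k < a (ord_pred i))%N -> Q (cell i (perim i - k.+1))) ->
    (forall i k, (k < s i)%N -> Q (rim (off i + k))) ->
  forall d, Q d.
Proof.
move=> Qs Qm Qb Qr; apply: wheel_dart_ind => // i k ltk.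
have [lt1|le1] := ltnP k (a i); first exact: Qs.
have [lt2|le2] := ltnP k (a i + s i).
  have -> : k = (a i + s i - (a i + s i - k.+1).+1)%N by lia.
  by apply: Qm; lia.
have -> : k = (perim i - (perim i - k.+1).+1)%N by lia.
by apply: Qb; rewrite /perim in ltk *; lia.
Qed.

Lemma wheel_einvK : involutive wheel_einv.
Proof.
move=> d; elim/wheel_side_ind: d => i k ltk.
- by rewrite einv_spoke // einv_spoke_back ordSK.
- by rewrite einv_cell_rim // einv_rim.
- by rewrite einv_spoke_back // einv_spoke // ord_predK.
by rewrite einv_rim // einv_cell_rim.
Qed.

Lemma wheel_fnext_inj : injective wheel_fnext.
Proof.
pose g (d : wheel_dart) : wheel_dart := match d with
  | inl t => inl (Tagged (fun i => 'I_(perim i)) (ord_pred (tagged t)))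
  | inr b => inr (ord_pred b)
  end.
by apply: (can_inj (g := g)) => -[[i k]|b] /=; rewrite ordSK.
Qed.

Lemma wheel_vnext_inj : injective wheel_vnext.
Proof. exact: inj_comp wheel_fnext_inj (inv_inj wheel_einvK). Qed.

Lemma wheel_einv_neq d : wheel_einv d != d.
Proof.
pose kind (d : wheel_dart) := match d with
  | inl t => ((tagged t < a (tag t)) + (tagged t < a (tag t) + s (tag t)))%N
  | inr _ => 3
  end.
have kind_cell i k : (k < perim i)%N ->
    kind (cell i k) = ((k < a i) + (k < a i + s i))%N.
  by move=> ltk; rewrite /= val_cell.
have kind_rim i k : (k < s i)%N -> kind (rim (off i + k)) = 3.
  by move=> ltk; rewrite -[(off i + k)%N]/(val (Ordinal (off_lt ltk))) rimE.
apply/eqP => /(congr1 kind); elim/wheel_side_ind: d => i k ltk.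
- have ai := a_gt0 i; rewrite einv_spoke // !kind_cell /perim ?ordSK; lia.
- by rewrite einv_cell_rim // kind_rim // kind_cell /perim; lia.
- have ap := a_gt0 i; rewrite einv_spoke_back // !kind_cell /perim; lia.
by rewrite einv_rim // kind_rim // kind_cell /perim; lia.
Qed.

Lemma vnext_spoke0 i : wheel_vnext (cell i 0) = cell (ordS i) 0.
Proof. by rewrite /wheel_vnext einv_spoke // subn1 fnext_cell0. Qed.

Lemma vnext_spoke i k : (0 < k < a i)%N ->
  wheel_vnext (cell i k) = cell (ordS i) (perim (ordS i) - k).
Proof.
move=> /andP[k0 ltk]; rewrite /wheel_vnext einv_spoke // fnext_cellS.
  by congr cell; rewrite /perim ordSK; lia.
by rewrite /perim ordSK; lia.
Qed.

Lemma vnext_spoke_back i k : (k < a (ord_pred i))%N ->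
  wheel_vnext (cell i (perim i - k.+1)) = cell (ord_pred i) k.+1.
Proof.
move=> ltk; rewrite /wheel_vnext einv_spoke_back // fnext_cellS //.
by rewrite /perim; have := a_gt0 (ord_pred (ord_pred i)); lia.
Qed.

Lemma vnext_cell_rim i k : (k < s i)%N ->
  wheel_vnext (cell i (a i + s i - k.+1)) = rim ((off i + k).+1 %% rim_size).
Proof.
by move=> ltk; rewrite /wheel_vnext einv_cell_rim // fnext_rim ?off_lt.
Qed.

Lemma vnext_rim i k : (k < s i)%N ->
  wheel_vnext (rim (off i + k)) = cell i (a i + s i - k).
Proof.
move=> ltk; rewrite /wheel_vnext einv_rim // fnext_cellS.
  by congr cell; lia.
by rewrite /perim; have := a_gt0 (ord_pred i); lia.
Qed.

(** The hub, the inner vertices of the spokes, and the vertices of the rim.  The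
    rim has [rim_size] vertices, except that an empty rim is a single vertex,
    where all spokes end: hence the [.-1.+1]. *)
Definition wheel_vertex : finType :=
  option ({i : 'I_n & 'I_(a i).-1} + 'I_rim_size.-1.+1)%type.

(** Used for [0 < k < a i] only, when the position [k] is coded by [k - 1]. *)
Definition spoke_vertex i k : wheel_vertex :=
  if (insub k.-1 : option 'I_(a i).-1) is Some j
  then Some (inl (Tagged (fun i => 'I_(a i).-1) j)) else None.

Definition rim_vertex x : wheel_vertex := Some (inr (inZp x)).

Definition wheel_origin (d : wheel_dart) : wheel_vertex :=
  match d with
  | inl t =>
    let i := tag t in let k : nat := tagged t in
    if k == 0%N then None
    else if (k < a i)%N then spoke_vertex i k
    else if (k <= a i + s i)%N then rim_vertex (off i + (a i + s i - k))
    else spoke_vertex (ord_pred i) (perim i - k)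
  | inr b => rim_vertex b
  end.

Lemma rim_vertex_mod x : rim_vertex (x %% rim_size) = rim_vertex x.
Proof.
congr (Some (inr _)); apply: val_inj => /=.
by case: rim_size => [|m] /=; rewrite ?modn1 // modn_mod.
Qed.

Lemma off_full : off n = rim_size.
Proof. by apply: eq_bigl => i; exact: ltn_ord. Qed.

Lemma off0 : off 0 = 0%N.
Proof. by rewrite /off big_pred0. Qed.

Lemma offS i : off i.+1 = (off i + s i)%N.
Proof.
rewrite /off (bigD1 i) ?ltnSn //= addnC; congr (_ + _)%N.
by apply: eq_bigl => j; rewrite ltnS ltn_neqAle andbC.
Qed.

(** The arc of polygon [i] starts on the rim where that of polygon [i-1] ends,
    both being the end of spoke [i-1]. *)
Lemma rim_vertex_pred i :
  rim_vertex (off (ord_pred i) + s (ord_pred i)) = rim_vertex (off i).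
Proof.
rewrite -[i in RHS]ord_predK; move: (ord_pred i) => j; rewrite -offS /=.
have := ltn_ord j; rewrite leq_eqVlt => /predU1P[->|ltj].
  by rewrite modnn off_full off0 -rim_vertex_mod modnn.
by rewrite modn_small.
Qed.

Lemma origin_cell i k : (k < perim i)%N -> wheel_origin (cell i k) =
    if k == 0%N then None
    else if (k < a i)%N then spoke_vertex i k
    else if (k <= a i + s i)%N then rim_vertex (off i + (a i + s i - k))
    else spoke_vertex (ord_pred i) (perim i - k).
Proof. by move=> ltk; rewrite /= val_cell. Qed.

Lemma origin_hub i : wheel_origin (cell i 0) = None.
Proof. by rewrite origin_cell ?perim_gt0. Qed.

Lemma origin_spoke i k : (0 < k < a i)%N ->
  wheel_origin (cell i k) = spoke_vertex i k.
Proof.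
move=> /andP[k0 ltk]; rewrite origin_cell; last by rewrite /perim; lia.
by rewrite ltk; case: k k0 {ltk}.
Qed.

Lemma origin_rim_cell i k : (k <= s i)%N ->
  wheel_origin (cell i (a i + s i - k)) = rim_vertex (off i + k).
Proof.
move=> lek; have := a_gt0 i; have := a_gt0 (ord_pred i) => ap ai.
rewrite origin_cell; last by rewrite /perim; lia.
rewrite ifN; last by lia.
rewrite ifN; last by lia.
by rewrite ifT; [congr (rim_vertex (_ + _)); lia | lia].
Qed.

Lemma origin_spoke_back i k : (0 < k < a (ord_pred i))%N ->
  wheel_origin (cell i (perim i - k)) = spoke_vertex (ord_pred i) k.
Proof.
move=> ltk; have ai := a_gt0 i.
rewrite origin_cell; last by rewrite /perim; lia.
rewrite ifN; last by rewrite /perim; lia.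
rewrite ifN; last by rewrite /perim; lia.
rewrite ifN; last by rewrite /perim; lia.
by congr spoke_vertex; rewrite /perim; lia.
Qed.

Lemma origin_rim x : (x < rim_size)%N -> wheel_origin (rim x) = rim_vertex x.
Proof. by move=> ltx; rewrite -[x in LHS]/(val (Ordinal ltx)) rimE. Qed.

Lemma origin_spoke_end i : wheel_origin (cell i (a i)) = rim_vertex (off i + s i).
Proof. by have := origin_rim_cell (leqnn (s i)); rewrite addnK. Qed.

Lemma origin_vnext d : wheel_origin (wheel_vnext d) = wheel_origin d.
Proof.
elim/wheel_side_ind: d => i k ltk.
- case: k ltk => [|k] ltk; first by rewrite vnext_spoke0 !origin_hub.
  rewrite vnext_spoke // origin_spoke_back ?ordSK // origin_spoke //.
- rewrite vnext_cell_rim // origin_rim_cell // addnS.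
  rewrite origin_rim ?rim_vertex_mod // ltn_mod.
  by rewrite (leq_ltn_trans _ (off_lt ltk)).
- rewrite vnext_spoke_back //; have [lt|ge] := ltnP k.+1 (a (ord_pred i)).
    by rewrite origin_spoke ?origin_spoke_back.
  have -> : k.+1 = a (ord_pred i) by lia.
  rewrite origin_spoke_end rim_vertex_pred.
  have -> : (perim i - a (ord_pred i) = a i + s i - 0)%N by rewrite /perim; lia.
  by rewrite origin_rim_cell ?addn0.
by rewrite vnext_rim // origin_rim ?off_lt // origin_rim_cell // ltnW.
Qed.

Definition wheel_rep (v : wheel_vertex) : wheel_dart :=
  match v with
  | None => cell i0 0
  | Some (inl t) => cell (tag t) (tagged t).+1
  | Some (inr b) => if (0 < rim_size)%N then rim b else cell i0 (a i0)
  end.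

Lemma wheel_repK : cancel wheel_rep wheel_origin.
Proof.
case=> [[[i k]|b]|]; rewrite [wheel_rep _]/=.
- have ltk := ltn_ord k; rewrite origin_spoke; last by lia.
  by rewrite /spoke_vertex /= valK.
- case: ifP => [S_gt0|S0].
    rewrite origin_rim; last by rewrite -[X in (_ < X)%N](prednK S_gt0).
    by congr (Some (inr _)); exact: valZpK.
  rewrite origin_spoke_end; congr (Some (inr _)); apply: val_inj => /=.
  have := ltn_ord b; move: (rim_size) b S0 => [|m] //= b _ ltb.
  by rewrite modn1; lia.
exact: origin_hub.
Qed.

Lemma fconnect_hub i j : fconnect wheel_vnext (cell i 0) (cell j 0).
Proof.
have [k <-] := iter_ordS_ex i j.
elim: k => [|k IHk]; first exact: connect0.
by apply: connect_trans IHk _; rewrite iterS -vnext_spoke0; exact: fconnect1.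
Qed.

Lemma vnext_spoke_end i : s i = 0%N ->
  wheel_vnext (cell i (a i)) = cell (ord_pred i) (a (ord_pred i)).
Proof.
move=> si0; have ap := a_gt0 (ord_pred i).
have -> : a i = (perim i - (a (ord_pred i)).-1.+1)%N by rewrite /perim; lia.
by rewrite vnext_spoke_back prednK.
Qed.

Lemma rep_rim_vertex x : (x < rim_size)%N -> wheel_rep (rim_vertex x) = rim x.
Proof.
move=> ltx; have S_gt0 : (0 < rim_size)%N by lia.
by rewrite /= S_gt0 prednK // modn_small.
Qed.

Lemma fconnect_cell_rim i k : (k < s i)%N ->
  fconnect wheel_vnext (cell i (a i + s i - k.+1))
    (wheel_rep (wheel_origin (cell i (a i + s i - k.+1)))).
Proof.
move=> ltk; rewrite -origin_vnext vnext_cell_rim //.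
have ltm : ((off i + k).+1 %% rim_size < rim_size)%N.
  by rewrite ltn_mod (leq_ltn_trans _ (off_lt ltk)).
by rewrite origin_rim // rep_rim_vertex // -vnext_cell_rim //; exact: fconnect1.
Qed.

(** Turning around the end of a spoke, [vnext] passes from spoke to spoke until a
    nonempty arc of the rim is met; when there is none, all spokes end at the
    same point. *)
Lemma fconnect_spoke_end i :
  fconnect wheel_vnext (cell i (a i)) (wheel_rep (wheel_origin (cell i (a i)))).
Proof.
pose stop j := (0 < s j)%N || (rim_size == 0%N) && (j == i0).
have [j stop_j] : exists j, stop j.
  have [S0|/eqP] := eqVneq rim_size 0%N.
    by exists i0; rewrite /stop S0 !eqxx orbT.
  move=> S_neq0; have [/existsP[j sj]|/existsPn s0] := boolP [exists j, (0 < s j)%N].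
    by exists j; rewrite /stop sj.
  by case: S_neq0; apply: big1 => j _; have := s0 j; lia.
have [k eqj] := iter_ord_pred_ex i j; rewrite -{j}eqj in stop_j.
elim: k i stop_j => [|k IHk] i stop_i.
  have [s_gt0|s0] := ltnP 0 (s i).
    have -> : a i = (a i + s i - (s i).-1.+1)%N by lia.
    by apply: fconnect_cell_rim; lia.
  rewrite /stop ltnNge s0 /= in stop_i; case/andP: stop_i => /eqP S0 /eqP ->.
  rewrite origin_spoke_end [wheel_rep _]/= ifF ?connect0 //.
  by rewrite S0.
have [s_gt0|s0] := ltnP 0 (s i).
  have -> : a i = (a i + s i - (s i).-1.+1)%N by lia.
  by apply: fconnect_cell_rim; lia.
have si0 : s i = 0%N by lia.
apply: connect_trans (fconnect1 _ _) _; rewrite -origin_vnext vnext_spoke_end //.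
by apply: IHk; rewrite -iterSr.
Qed.

Lemma fconnect_rep d : fconnect wheel_vnext d (wheel_rep (wheel_origin d)).
Proof.
elim/wheel_side_ind: d => i k ltk.
- case: k ltk => [|k] ltk; first by rewrite origin_hub; exact: fconnect_hub.
  rewrite origin_spoke // /spoke_vertex /=.
  have ltk' : (k < (a i).-1)%N by lia.
  by rewrite (insubT (fun x => x < (a i).-1)%N ltk') /= connect0.
- exact: fconnect_cell_rim.
- apply: connect_trans (fconnect1 _ _) _; rewrite -origin_vnext.
  rewrite vnext_spoke_back //; have [lt|ge] := ltnP k.+1 (a (ord_pred i)).
    rewrite origin_spoke // /spoke_vertex /=.
    have ltk' : (k < (a (ord_pred i)).-1)%N by lia.
    by rewrite (insubT (fun x => x < (a (ord_pred i)).-1)%N ltk') /= connect0.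
  have -> : k.+1 = a (ord_pred i) by lia.
  exact: fconnect_spoke_end.
by rewrite origin_rim ?off_lt // rep_rim_vertex ?off_lt ?connect0.
Qed.

Lemma fcard_wheel_vnext : fcard wheel_vnext predT = #|wheel_vertex|.
Proof.
exact: fcard_invariant wheel_vnext_inj origin_vnext fconnect_rep wheel_repK.
Qed.

Lemma iter_fnext_cell i k : (k < perim i)%N ->
  iter k wheel_fnext (cell i 0) = cell i k.
Proof.
elim: k => // k IHk ltk; rewrite iterS IHk 1?ltnW // fnext_cellS //.
Qed.

Lemma iter_fnext_rim k x : (x < rim_size)%N ->
  iter k wheel_fnext (rim x) = rim ((x + k) %% rim_size).
Proof.
move=> ltx; elim: k => [|k IHk]; first by rewrite addn0 modn_small.
rewrite iterS IHk fnext_rim ?ltn_mod ?(leq_ltn_trans _ ltx) //.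
by rewrite -addn1 modnDml addn1 addnS.
Qed.

Lemma fconnect_cell i k : (k < perim i)%N ->
  fconnect wheel_fnext (cell i 0) (cell i k).
Proof. by move=> ltk; rewrite -(iter_fnext_cell ltk); exact: fconnect_iter. Qed.

Lemma fconnect_rim x y : (x < rim_size)%N -> (y < rim_size)%N ->
  fconnect wheel_fnext (rim x) (rim y).
Proof.
move=> ltx lty; have -> : rim y = iter (rim_size - x + y) wheel_fnext (rim x).
  by rewrite iter_fnext_rim // addnA subnKC ?modnDl ?modn_small // ltnW.
exact: fconnect_iter.
Qed.

(** The outside of the rim is a face only if the rim is not empty, whence the
    [minn]. *)
Definition wheel_face : finType := ('I_n + 'I_(minn rim_size 1))%type.

Lemma rim_face_subproof (b : 'I_rim_size) : (0 < minn rim_size 1)%N.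
Proof. by rewrite leq_min (leq_ltn_trans _ (ltn_ord b)). Qed.

Definition wheel_face_of (d : wheel_dart) : wheel_face :=
  match d with
  | inl t => inl (tag t)
  | inr b => inr (Ordinal (rim_face_subproof b))
  end.

Definition wheel_face_rep (f : wheel_face) : wheel_dart :=
  match f with inl i => cell i 0 | inr _ => rim 0 end.

Lemma fcard_wheel_fnext : fcard wheel_fnext predT = #|wheel_face|.
Proof.
apply: (@fcard_invariant _ _ _ wheel_face_of wheel_face_rep).
- exact: wheel_fnext_inj.
- by case=> [t|b] //=; congr inr; apply: val_inj.
- elim/wheel_dart_ind => i k ltk /=.
    by rewrite (fconnect_sym wheel_fnext_inj) fconnect_cell.
  have ltr := off_lt ltk; rewrite -[(off i + k)%N]/(val (Ordinal ltr)) rimE /=.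
  by rewrite -rimE; apply: fconnect_rim; rewrite // (leq_ltn_trans _ ltr).
case=> [//|u]; have := ltn_ord u; rewrite leq_min => /andP[ltu _].
have S_gt0 : (0 < rim_size)%N by exact: leq_ltn_trans ltu.
have rim0 : rim 0 = inr (Ordinal S_gt0) := rimE (Ordinal S_gt0).
rewrite /wheel_face_rep rim0 /=; congr inr; apply: val_inj => /=.
have := ltn_ord u; lia.
Qed.

Lemma sum_a : (\sum_(i < n) (a i).-1 + n = \sum_(i < n) a i)%N.
Proof.
rewrite -[X in (_ + X)%N]card_ord -sum1_card -big_split; apply: eq_bigr => i _ /=.
by rewrite addn1 prednK.
Qed.

Lemma sum_perim : (\sum_(i < n) perim i = (\sum_(i < n) a i) * 2 + rim_size)%N.
Proof.
have eqa : (\sum_i a (ord_pred i) = \sum_i a i)%N.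
  by rewrite [RHS](reindex_inj (@ord_pred_inj n)).
by rewrite !big_split /= eqa muln2 -addnn addnAC.
Qed.

(** With [A] the sum of the [a i] and [S] that of the [s i], there are
    [1 + (A - n) + max S 1] vertices, [A + S] edges and [n + min S 1] faces. *)
Lemma wheel_euler :
  (fcard wheel_vnext predT + fcard (wheel_vnext \o wheel_einv) predT
   = fcard wheel_einv predT + 2)%N.
Proof.
have -> : fcard (wheel_vnext \o wheel_einv) predT = fcard wheel_fnext predT.
  by apply: eq_fcard => d; rewrite /= /wheel_vnext wheel_einvK.
have cardE := fcard_involution wheel_einvK wheel_einv_neq.
rewrite fcard_wheel_vnext fcard_wheel_fnext.
have cardV : #|wheel_vertex| = (\sum_(i < n) (a i).-1 + rim_size.-1.+1).+1.
  by rewrite card_option card_sum card_ord tagnat.card.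
have cardF : #|wheel_face| = (n + minn rim_size 1)%N.
  by rewrite card_sum !card_ord.
have cardD : #|wheel_dart| = (\sum_(i < n) perim i + rim_size)%N.
  by rewrite card_sum card_ord tagnat.card.
rewrite cardV cardF; rewrite cardD sum_perim -sum_a in cardE; lia.
Qed.

Lemma wheel_connected d d' :
  connect (relU (frel wheel_vnext) (frel wheel_einv)) d d'.
Proof.
set e := relU _ _.
have sub_v u v : fconnect wheel_vnext u v -> connect e u v.
  by apply: connect_sub => {u v} u v /= uv; apply: connect1; rewrite /= uv.
have sub_e u : connect e u (wheel_einv u) by apply: connect1; rewrite /= eqxx orbT.
have sub_f u v : fconnect wheel_fnext u v -> connect e u v.
  apply: connect_sub => {u v} u v /eqP <-; apply: connect_trans (sub_e u) _.
  by apply/sub_v; rewrite -{2}(wheel_einvK u) fconnect1.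
have to_hub u : connect e u (cell i0 0) /\ connect e (cell i0 0) u.
  have cellP i k : (k < perim i)%N ->
      connect e (cell i k) (cell i0 0) /\ connect e (cell i0 0) (cell i k).
    move=> ltk; have con := fconnect_cell ltk; split.
      apply: connect_trans (sub_v _ _ (fconnect_hub i i0)); apply: sub_f.
      by rewrite (fconnect_sym wheel_fnext_inj).
    exact: connect_trans (sub_v _ _ (fconnect_hub i0 i)) (sub_f _ _ con).
  elim/wheel_dart_ind: u => i k ltk; first exact: cellP.
  have ltp : (a i + s i - k.+1 < perim i)%N.
    by rewrite /perim; have := a_gt0 (ord_pred i); lia.
  have [to from] := cellP _ _ ltp; split.
    by apply: connect_trans (sub_e _) _; rewrite einv_rim.
  by apply: connect_trans from _; rewrite -einv_cell_rim //; exact: sub_e.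
exact: connect_trans (to_hub d).1 (to_hub d').2.
Qed.

Definition wheel : sphere_map :=
  SphereMap wheel_vnext_inj wheel_einvK wheel_einv_neq wheel_connected wheel_euler.

End Wheel.

(** * From cycles to interior vertices *)

(** The wheel of a cycle [c] of [Gamma(P)]: polygon [i] is labeled by the relator
    [r i = q s p] of [c i], and [p] is read along the spoke of polygon [i-1]
    because [g_p (c i)] is the inverse of [g_q (c (i-1))].  The letter [x0] is a
    default value that is never read. *)
Section WheelDiagram.
Variables (X : Type) (P : presentation X) (x0 : letter X).
Variables (n : nat) (c : 'I_n -> Gamma_vertex P).
Hypotheses (n_gt2 : (2 < n)%N) (cyc : directed_cycle c).
Implicit Types (i j : 'I_n) (k l : nat).

Let i0 : 'I_n := Ordinal (ltn_trans (ltn0Sn 1) n_gt2).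
Let r i := g_rel (c i).
Let a i := size (g_q (c i)).
Let s i := (size (r i) - a i - size (g_p (c i)))%N.

Let a_gt0 i : (0 < a i)%N.
Proof. by have [] := g_qP (c i); rewrite /a; case: (g_q _). Qed.

Let g_p_pred i : g_p (c i) = winv (g_q (c (ord_pred i))).
Proof. by have [] := cyc (ord_pred i); rewrite ord_predK. Qed.

Let size_g_p i : size (g_p (c i)) = a (ord_pred i).
Proof. by rewrite g_p_pred size_winv. Qed.

Let size_r i : size (r i) = perim a s i.
Proof.
have [w eqr] := g_split (c i); rewrite /perim -size_g_p /s /a /r eqr !size_cat.
by lia.
Qed.

Let r_glue i k : (k < a (ord_pred i))%N ->
  nth x0 (r i) (perim a s i - k.+1) = linv (nth x0 (r (ord_pred i)) k).
Proof.
move=> ltk; rewrite -size_r; have sizep := size_g_p i.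
have [w eqw] := g_split (c (ord_pred i)); have [u eqr] := g_split (c i).
rewrite /r eqw nth_cat -/(a _) ltk eqr catA nth_cat [size (_ ++ g_p _)]size_cat.
rewrite sizep ifN; last by lia.
rewrite g_p_pred nth_winv -/(a _); last by lia.
by congr (linv (nth _ _ _)); lia.
Qed.

Local Notation cell := (cell s a_gt0).
Local Notation rim := (rim i0 s a_gt0).
Local Notation off := (off s).
Local Notation perim := (perim a s).
Let S := wheel i0 s a_gt0.

Let side_label (d : S) : letter X :=
  match d with inl t => nth x0 (r (tag t)) (tagged t) | inr _ => x0 end.

Let wheel_label (d : S) : letter X :=
  match d with inl _ => side_label d | inr _ => linv (side_label (einv d)) end.

Let outside (d : S) : bool := if d is inr _ then true else false.

Let label_cell i k : (k < perim i)%N -> wheel_label (cell i k) = nth x0 (r i) k.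
Proof. by move=> ltk; rewrite /= val_cell. Qed.

Let label_rim i k : (k < s i)%N ->
  wheel_label (rim (off i + k)) = linv (nth x0 (r i) (a i + s i - k.+1)).
Proof.
move=> ltk; have := einv_rim i0 a_gt0 ltk.
rewrite -[(off i + k)%N]/(val (Ordinal (off_lt ltk))) rimE /wheel_label => einvE.
rewrite [einv _]einvE -label_cell //.
by rewrite /Defs.dart /perim; have := a_gt0 (ord_pred i); lia.
Qed.

Let outside_rim i k : (k < s i)%N -> outside (rim (off i + k)).
Proof.
by move=> ltk; rewrite -[(off i + k)%N]/(val (Ordinal (off_lt ltk))) rimE.
Qed.

Let fnextE (d : S) : fnext d = wheel_fnext d.
Proof. by rewrite /fnext /= /wheel_vnext wheel_einvK. Qed.

Let outside_fnext (d : S) : outside (fnext d) = outside d.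
Proof. by rewrite fnextE; case: d. Qed.

Let wheel_label_einv (d : S) : wheel_label (einv d) = linv (wheel_label d).
Proof.
move: d; apply: (@wheel_side_ind _ i0 a s a_gt0) => i k ltk.
- rewrite [einv _]einv_spoke // !label_cell.
  + by rewrite -{3}(ordSK i) r_glue ordSK.
  + by rewrite /perim; lia.
  by rewrite /perim ordSK; have := a_gt0 (ordS i); lia.
- rewrite [einv _]einv_cell_rim // label_rim // label_cell //.
  by rewrite /perim; have := a_gt0 (ord_pred i); lia.
- rewrite [einv _]einv_spoke_back // !label_cell ?r_glue ?linvK //.
    by rewrite /perim; have := a_gt0 i; lia.
  by rewrite /perim; have := a_gt0 i; lia.
rewrite [einv _]einv_rim // label_rim // label_cell ?linvK //.
by rewrite /perim; have := a_gt0 (ord_pred i); lia.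
Qed.

Let iter_fnext_wheel i k : (k < perim i)%N ->
  iter k (@fnext S) (cell i 0) = cell i k.
Proof.
by move=> ltk; rewrite (eq_iter fnextE) iter_fnext_cell.
Qed.

Let cell_inj i j k l : (k < perim i)%N -> (l < perim j)%N ->
  cell i k = cell j l -> i = j /\ k = l.
Proof.
move=> ltk ltl; pose pos (d : S) : 'I_n * nat :=
  match d with inl t => (tag t, nat_of_ord (tagged t)) | inr _ => (i0, 0%N) end.
by move/(congr1 pos) => /=; rewrite !val_cell // => -[].
Qed.

Let fnext_wheel_inj : injective (@fnext S).
Proof. exact: inj_comp (@vnext_inj S) (inv_inj (@einvK S)). Qed.

Let order_cell i : order (@fnext S) (cell i 0) = perim i.
Proof.
have p_gt0 := perim_gt0 s a_gt0 i.
apply: order_first_return => // [|k /andP[k0 ltk]].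
  rewrite -(prednK p_gt0) iterS iter_fnext_wheel ?prednK // fnextE.
  exact: fnext_cell0.
rewrite iter_fnext_wheel //; apply/eqP => /(cell_inj ltk p_gt0)[_ k0'].
by rewrite k0' in k0.
Qed.

Let face_cell i k : (k < perim i)%N ->
  face_label wheel_label (cell i k) = rot k (r i).
Proof.
move=> ltk; have ltko : (k < order (@fnext S) (cell i 0))%N by rewrite order_cell.
have con : fconnect (@fnext S) (cell i 0) (cell i k).
  by rewrite -(iter_fnext_wheel ltk) fconnect_iter.
rewrite /face_label (orbit_fconnect fnext_wheel_inj con).
rewrite -{1}(iter_fnext_wheel ltk) findex_iter // map_rot; congr rot.
apply: (@eq_from_nth _ x0); rewrite size_map size_orbit order_cell ?size_r // => l ltl.
rewrite (nth_map (cell i 0)) ?size_orbit ?order_cell // nth_traject ?order_cell //.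
by rewrite iter_fnext_wheel // label_cell.
Qed.

Let wheel_label_face (d : S) : ~~ outside d -> Rstar P (face_label wheel_label d).
Proof.
move: d; apply: (@wheel_dart_ind _ i0 a s a_gt0) => i k ltk; last by rewrite outside_rim.
by move=> _; rewrite face_cell //; apply/Rstar_rot/g_relP.
Qed.

Definition wheel_diagram : diagram P :=
  Diagram outside_fnext wheel_label_einv wheel_label_face.

Let M := wheel_diagram.

(** Two polygons sharing a spoke read it from the hub in [r i] and in
    [(r (i+1))^-1].  A reducible pair along it would make rotations of these two
    words by the same amount equal, hence the words themselves. *)
Lemma wheel_reduced : reduced wheel_diagram.
Proof.
case; apply: (@wheel_side_ind _ i0 a s a_gt0) => i k ltk [].
- move=> _ _ _; rewrite fnext_einv.
  have ltp : (k < perim i)%N by rewrite /perim; lia.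
  have -> : face_label (@label _ _ M) (vnext (cell i k : M))
            = rot (size (r (ordS i)) - k) (r (ordS i)).
    case: k ltk {ltp} => [|k] ltk.
      rewrite [vnext _]vnext_spoke0 [LHS]face_cell ?perim_gt0 //.
      by rewrite rot0 subn0 rot_size.
    rewrite [vnext _]vnext_spoke // [LHS]face_cell ?size_r //.
    by rewrite /perim ordSK; lia.
  rewrite [LHS]face_cell // winv_rot subKn; last first.
    by rewrite size_r /perim ordSK; lia.
  move/rot_inj => eqr; have [_] := cyc i; apply.
  by rewrite -/(r _) -/(r i) eqr winvK.
- by move=> _ /negP[]; rewrite [einv _]einv_cell_rim //; exact: outside_rim.
- move=> _ _ _; rewrite fnext_einv [vnext _]vnext_spoke_back // => eqf.
  have lti : (perim i - k.+1 < perim i)%N by rewrite /perim; have := a_gt0 i; lia.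
  have ltp : (k.+1 < perim (ord_pred i))%N.
    by rewrite /perim; have := a_gt0 (ord_pred (ord_pred i)); lia.
  rewrite [LHS]face_cell // [face_label _ _]face_cell // in eqf.
  have eqsz := congr1 size eqf; rewrite size_winv !size_rot in eqsz.
  rewrite winv_rot -eqsz -size_r in eqf.
  move/rot_inj: eqf => eqr; have [_] := cyc (ord_pred i).
  by rewrite ord_predK; apply.
by move=> /negP[]; exact: outside_rim.
Qed.

Let vnext2_neq i : ord_pred (ord_pred i) <> i.
Proof. exact/eqP/ord_pred2_neq. Qed.

Let hub : M := cell i0 0.

Let iter_vnext_hub k : iter k (@vnext M) hub = cell (iter k (@ordS n) i0) 0.
Proof. by elim: k => //= k ->; exact: vnext_spoke0. Qed.

Let val_iter_ordS0 k : (k < n)%N -> iter k (@ordS n) i0 = k :> nat.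
Proof. by move=> ltk; rewrite iter_ordS add0n modn_small. Qed.

Lemma degree_hub : degree hub = n.
Proof.
apply: order_first_return; [exact: vnext_inj | exact: ltnW (ltnW n_gt2) | |].
  rewrite iter_vnext_hub; congr (cell _ 0); apply: val_inj.
  by rewrite /= iter_ordS add0n modnn.
move=> k /andP[k_gt0 ltk]; rewrite iter_vnext_hub; apply/eqP.
case/(cell_inj (perim_gt0 _ a_gt0 _) (perim_gt0 _ a_gt0 _)) => eqi _.
have := val_iter_ordS0 ltk; rewrite eqi /= => k0; by rewrite -k0 in k_gt0.
Qed.

Lemma interior_hub : interior hub.
Proof.
apply/forallP => d; apply/implyP => /iter_findex <-.
by rewrite iter_vnext_hub.
Qed.

Let smooth_spoke i k : (0 < k < a i)%N -> smooth (cell i k : M).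
Proof.
move=> /andP[k_gt0 ltk]; set d : M := cell i k.
have vd : vnext d = cell (ordS i) (perim (ordS i) - k).
  by rewrite [vnext _]vnext_spoke ?k_gt0.
have vvd : vnext (vnext d) = d.
  have ltk' : (k.-1 < a (ord_pred (ordS i)))%N by rewrite ordSK; lia.
  have := vnext_spoke_back i0 s a_gt0 ltk'; rewrite ordSK prednK // => eqv.
  by rewrite vd [vnext _]eqv.
have vd_neq : vnext d != d.
  have ltk1 : (perim (ordS i) - k < perim (ordS i))%N by rewrite /perim ordSK; lia.
  have ltk2 : (k < perim i)%N by rewrite /perim; lia.
  apply/eqP; rewrite vd => /(cell_inj ltk1 ltk2)[eqi _].
  have eqp : ord_pred i = i by rewrite -{1}eqi ordSK.
  by apply: (@vnext2_neq i); rewrite !eqp.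
have deg2 : degree d = 2%N.
  by apply: order_first_return => //; [exact: vnext_inj | case=> [|[|]]].
rewrite /smooth deg2 eqxx andbT; apply/forallP => e; apply/implyP => con.
rewrite -(iter_findex con); have := findex_max con.
rewrite -/(degree d) deg2; case: (findex _ _ _) => [|[|//]] // _.
by rewrite [iter _ _ _]vd.
Qed.

(** With a nonempty rim the end of a spoke lies on the boundary.  Otherwise it
    belongs to all spokes, and turning twice around it leads from spoke [i] to
    spoke [i-2]. *)
Let not_smooth_spoke_end i : ~~ smooth (cell i (a i) : M).
Proof.
apply/negP => /andP[/forallP int /eqP deg2]; have [S0|] := posnP (rim_size s).
  have s0 j : s j = 0%N.
    by apply/eqP; move/eqP: S0; rewrite sum_nat_eq0 => /forallP/(_ j).
  have vv : vnext (vnext (cell i (a i) : M)) = cell i (a i).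
    by have := iter_order (@vnext_inj M) (cell i (a i)); rewrite -/(degree _) deg2.
  have vend j : vnext (cell j (a j) : M) = cell (ord_pred j) (a (ord_pred j)).
    exact: vnext_spoke_end (s0 j).
  rewrite (congr1 (@vnext M) (vend i)) vend in vv.
  have lta j : (a j < perim j)%N by rewrite /perim; have := a_gt0 (ord_pred j); lia.
  by case: (cell_inj (lta _) (lta _) vv) => /vnext2_neq.
move=> S_gt0; set x := ((off i + s i) %% rim_size s)%N.
have ltx : (x < rim_size s)%N by rewrite ltn_mod.
have con : fconnect (@vnext M) (cell i (a i)) (rim x).
  have := fconnect_spoke_end i0 s a_gt0 i.
  by rewrite origin_spoke_end -rim_vertex_mod rep_rim_vertex.
have := int (rim x); rewrite con.
by rewrite -[x]/(val (Ordinal ltx)) rimE.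
Qed.

Lemma edge_length_spoke i : edge_length (cell i 0 : M) = a i.
Proof.
have lta : (a i < perim i)%N by rewrite /perim; have := a_gt0 (ord_pred i); lia.
apply: edge_length_eq => [|k ltk|].
- by rewrite a_gt0 [order _ _]order_cell ltnW.
- by rewrite iter_fnext_wheel ?smooth_spoke //; lia.
by rewrite iter_fnext_wheel // not_smooth_spoke_end.
Qed.

Lemma dF_hub : dF hub = n%:R - cycle_weight c.
Proof.
have finv_cell i : finv (@vnext M) (cell i 0) = cell (ord_pred i) 0.
  apply: (@vnext_inj M); rewrite f_finv; last exact: vnext_inj.
  by rewrite [RHS]vnext_spoke0 ord_predK.
rewrite /cycle_weight /Gamma_weight sumrB sumr_const card_ord subKr.
rewrite /dF sum_fconnect.
pose F (d : M) : rat := (edge_length d + edge_length (finv (@vnext M) d))%:R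
  / (relator_length d)%:R.
rewrite -(big_mkord xpredT (fun k => F (iter k (@vnext M) hub))).
rewrite -/(degree hub) degree_hub big_mkord; apply: eq_bigr => i _.
have -> : iter i (@vnext M) hub = cell i 0.
  by rewrite iter_vnext_hub; congr (cell _ 0); apply: val_inj; rewrite /= val_iter_ordS0.
rewrite /F finv_cell !edge_length_spoke /relator_length [face_label _ _]face_cell.
  by rewrite rot0 size_g_p addnC.
exact: perim_gt0.
Qed.

Lemma wheel_diagram_spec : exists (M : diagram P) (v : M),
  [/\ reduced M, interior v, degree v = n & dF v = n%:R - cycle_weight c].
Proof.
exists wheel_diagram, hub.
by split; [exact: wheel_reduced | exact: interior_hub | exact: degree_hub | exact: dF_hub].
Qed.

End WheelDiagram.

Lemma cycle_diagram (X : Type) (P : presentation X) n (c : 'I_n -> Gamma_vertex P) :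
    (2 < n)%N -> directed_cycle c ->
  exists (M : diagram P) (v : M),
    [/\ reduced M, interior v, degree v = n & dF v = n%:R - cycle_weight c].
Proof.
move=> n_gt2 cyc; have [] := g_qP (c (Ordinal (ltnW (ltnW n_gt2)))).
case: (g_q _) => [//|x0 w] _ _; exact: (wheel_diagram_spec x0 n_gt2 cyc).
Qed.

(* Hone says that no relator of length one is a piece: it cannot be dropped, as
   <x | x, x^2> shows, where Gamma has no edges but a sphere made of one face
   x^2 and two loops bounding faces x violates tau'. *)
Theorem corollary5p2 (X : Type) (P : presentation X)
  (Hone : forall r : word X, relator P r -> size r = 1%N -> ~ piece P r) :
  (tau' P <->
     forall (n : nat) (c : 'I_n -> Gamma_vertex P),
       (3 <= n)%N -> directed_cycle c -> 2 <= cycle_weight c)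
  /\
  (tau'_lt P <->
     forall (n : nat) (c : 'I_n -> Gamma_vertex P),
       (3 <= n)%N -> directed_cycle c -> 2 < cycle_weight c).
Proof.
have deg n : (3 <= n)%N -> n <> 2%N by case: n => [|[|[|n]]].
split; split.
- move=> tauP n c n_gt2 cyc.
  have [M [v [redM intv degv dFv]]] := cycle_diagram n_gt2 cyc.
  have := tauP M redM v intv; rewrite dFv degv => /(_ (deg _ n_gt2)); lra.
- move=> Hcyc M redM v intv deg2.
  have [c [n_gt2 cyc wc]] := interior_cycle redM (relator_not_piece Hone Hcyc) intv deg2.
  by have := Hcyc _ c n_gt2 cyc; rewrite wc; lra.
- move=> tauP n c n_gt2 cyc.
  have [M [v [redM intv degv dFv]]] := cycle_diagram n_gt2 cyc.
  have := tauP M redM v intv; rewrite dFv degv => /(_ (deg _ n_gt2)); lra.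
move=> Hcyc M redM v intv deg2.
have Hcyc' n c := fun n_gt2 cyc => ltW (Hcyc n c n_gt2 cyc).
have [c [n_gt2 cyc wc]] := interior_cycle redM (relator_not_piece Hone Hcyc') intv deg2.
by have := Hcyc _ c n_gt2 cyc; rewrite wc; lra.
Qed.
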